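(* Let $\mathbb{F}$ be a field, let $X$ be an object of the variety $\mathbf{ACAAssoc}$ of anti-commutative anti-associative algebras over $\mathbb{F}$ and let $U\colon\mathbf{ACAAssoc}\to\mathbf{PAlg}$ denote the forgetful functor to the category of partial algebras. (1) There exists a natural isomorphism $$\mathrm{SplExt}(-,X)\cong\mathrm{Hom}_{\mathbf{PAlg}}(U(-),[X]),$$ where $\mathrm{SplExt}(-,X)=\mathrm{SplExt}_{\mathbf{ACAAssoc}}(-,X)$. (2) If $[X]$ is an anti-commutative anti-associative algebra, then the functor $\mathrm{SplExt}(-,X)$ is representable and $[X]$ is the actor of $X$.
   Context: $\mathbf{ACAAssoc}$: $\mathbb{F}$-vector spaces with a bilinear multiplication satisfying $xy=-yx$ and $x(yz)=-(xy)z$; morphisms are multiplicative linear maps. A partial algebra $(Y,\cdot,\Omega)$ is a vector space $Y$ with a map $\cdot\colon\Omega\to Y$, $\Omega\subseteq Y\times Y$, where for each fixed $y$ the sets $\{x\mid(x,y)\in\Omega\}$ and $\{x\mid(y,x)\in\Omega\}$ are subspaces and $\cdot$ is linear in each variable on them. A homomorphism $(Y,\cdot,\Omega)\to(Y',\ast,\Omega')$ is a linear map $f$ such that $(x,y)\in\Omega$ implies $(f(x),f(y))\in\Omega'$ and $f(x\cdot y)=f(x)\ast f(y)$. $\mathbf{PAlg}$ is the category of partial algebras; an algebra is a partial algebra with $\Omega=Y\times Y$ (total). $[X]=\{f\in\mathrm{End}(X)\mid f(xy)=-f(x)y,\ \forall x,y\in X\}$ (linear endomorphisms), with partial operation $\langle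 f,g\rangle=-f\circ g$ defined on $\Omega=\{(f,g)\in[X]^2\mid f\circ g\in[X]\}$. ''$[X]$ is an anti-commutative anti-associative algebra'' means that this operation is total and makes $[X]$ an object of $\mathbf{ACAAssoc}$. A split extension of $B$ by $X$ is a diagram $X\xrightarrow{i}A\rightleftarrows B$ in $\mathbf{ACAAssoc}$ with $\pi\colon A\to B$, $s\colon B\to A$, $\pi s=1_B$, $i$ a kernel of $\pi$. $\mathrm{SplExt}(-,X)\colon\mathbf{ACAAssoc}^{\mathrm{op}}\to\mathbf{Set}$ sends $B$ to the set of isomorphism classes (isomorphisms fixing $X$ and $B$) of split extensions of $B$ by $X$, and $f\colon B'\to B$ to pullback along $f$. An actor of $X$ is an object $A_X$ of the category together with a natural isomorphism $\mathrm{SplExt}(-,X)\cong\mathrm{Hom}(-,A_X)$. *)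

(* Defs.v *)
From HB Require Import structures.
From mathcomp Require Import all_boot all_algebra.
From mathcomp Require Import boolp classical_sets functions.

Set Implicit Arguments.
Unset Strict Implicit.
Unset Printing Implicit Defensive.

Import GRing.Theory.
Local Open Scope ring_scope.
Local Open Scope classical_set_scope.

Local Obligation Tactic := idtac.

Record category := Category {
  obj :> Type;
  hom : obj -> obj -> Type;
  idm : forall a, hom a a;
  compm : forall a b c, hom b c -> hom a b -> hom a c;
  comp1m : forall a b (f : hom a b), compm (idm b) f = f;
  compm1 : forall a b (f : hom a b), compm f (idm a) = f;
  compmA : forall a b c d (h : hom c d) (g : hom b c) (f : hom a b),
    compm h (compm g f) = compm (compm h g) f }.
Arguments hom {_}.
Arguments idm {_}.

Record functor (C D : category) := Functor {
  fobj :> C -> D;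
  fmap : forall a b, hom a b -> hom (fobj a) (fobj b);
  fmap1 : forall a, fmap (idm a) = idm (fobj a);
  fmapM : forall a b c (g : hom b c) (f : hom a b),
    fmap (compm g f) = compm (fmap g) (fmap f) }.

(* Functors C^op -> Set. *)
Record presheaf (C : category) := Presheaf {
  pobj :> C -> Type;
  pmap : forall a b, hom a b -> pobj b -> pobj a;
  pmap1 : forall a x, pmap (idm a) x = x;
  pmapM : forall a b c (g : hom b c) (f : hom a b) x,
    pmap (compm g f) x = pmap f (pmap g x) }.

Record nat_iso (C : category) (P Q : presheaf C) := NatIso {
  nat_fun :> forall a, P a -> Q a;
  nat_bij : forall a, bijective (@nat_fun a);
  nat_comm : forall a b (f : hom a b) x,
    nat_fun (pmap f x) = pmap f (nat_fun x) }.

Program Definition homTo (C : category) (c : C) : presheaf C :=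
  @Presheaf C (fun a => hom a c) (fun a b f g => compm g f) _ _.
Next Obligation. by move=> C c a f; exact: compm1. Qed.
Next Obligation. by move=> C c a b d g f x; exact: compmA. Qed.

Program Definition precomp (C D : category) (P : presheaf D) (U : functor C D)
    : presheaf C :=
  @Presheaf C (fun a => P (U a)) (fun a b f => pmap (fmap U f)) _ _.
Next Obligation. by move=> C D P U a x /=; rewrite fmap1 pmap1. Qed.
Next Obligation. by move=> C D P U a b c g f x /=; rewrite fmapM pmapM. Qed.

Definition representable (C : category) (P : presheaf C) : Prop :=
  exists c : C, inhabited (nat_iso P (homTo c)).

(* In characteristic 2, [amulC] does not force [amul x x = 0]. *)
Record acaAlg (F : fieldType) := AcaAlg {
  aca_car :> lmodType F;
  amul : aca_car -> aca_car -> aca_car;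
  amul_linr : forall x, linear (amul x);
  amul_linl : forall y, linear (amul ^~ y);
  amulC : forall x y, amul x y = - amul y x;
  amulA : forall x y z, amul x (amul y z) = - amul (amul x y) z }.

Lemma amul0l (F : fieldType) (A : acaAlg F) (y : A) : amul 0 y = 0.
Proof.
have /= := amul_linl y (-1) 0 0.
by rewrite scaler0 addr0 scaleN1r addNr.
Qed.

Lemma amul0r (F : fieldType) (A : acaAlg F) (x : A) : amul x 0 = 0.
Proof. by rewrite amulC amul0l oppr0. Qed.

Record aca_hom (F : fieldType) (A B : acaAlg F) := AcaHom {
  aca_fun :> A -> B;
  aca_lin : linear aca_fun;
  aca_mul : forall x y, aca_fun (amul x y) = amul (aca_fun x) (aca_fun y) }.

HB.instance Definition _ (F : fieldType) (A B : acaAlg F) (f : aca_hom A B) :=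
  GRing.isLinear.Build F A B *:%R (aca_fun f) (aca_lin f).

Lemma aca_homP (F : fieldType) (A B : acaAlg F) (f g : aca_hom A B) :
  f =1 g -> f = g.
Proof.
case: f g => [f lf mf] [g lg mg] /= /funext fg; subst g.
by congr AcaHom; exact: Prop_irrelevance.
Qed.

Section AcaAssoc.
Variable F : fieldType.
Implicit Types A B C : acaAlg F.

Program Definition aca_id A : aca_hom A A := @AcaHom F A A id _ _.
Next Obligation. by []. Qed.
Next Obligation. by []. Qed.

Program Definition aca_comp A B C (g : aca_hom B C) (f : aca_hom A B)
  : aca_hom A C := @AcaHom F A C (g \o f) _ _.
Next Obligation. by move=> A B C g f a x y /=; rewrite !linearP. Qed.
Next Obligation. by move=> A B C g f x y /=; rewrite !aca_mul. Qed.

Program Definition ACAAssoc : category :=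
  @Category (acaAlg F) (@aca_hom F) aca_id aca_comp _ _ _.
Next Obligation. by move=> *; exact: aca_homP. Qed.
Next Obligation. by move=> *; exact: aca_homP. Qed.
Next Obligation. by move=> *; exact: aca_homP. Qed.

End AcaAssoc.

Definition subspace (F : fieldType) (V : lmodType F) (S : set V) : Prop :=
  S 0 /\ forall (a : F) u v, S u -> S v -> S (a *: u + v).

Record pAlg (F : fieldType) := PartialAlg {
  palg_car :> lmodType F;
  pdom : set (palg_car * palg_car);
  pmul : forall x y, pdom (x, y) -> palg_car;
  pdom_subl : forall y, subspace [set x | pdom (x, y)];
  pdom_subr : forall y, subspace [set x | pdom (y, x)];
  pmul_linl : forall a x x' y (h : pdom (x, y)) (h' : pdom (x', y))
    (h'' : pdom (a *: x + x', y)), pmul h'' = a *: pmul h + pmul h';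
  pmul_linr : forall a x x' y (h : pdom (y, x)) (h' : pdom (y, x'))
    (h'' : pdom (y, a *: x + x')), pmul h'' = a *: pmul h + pmul h' }.

Record palg_hom (F : fieldType) (Y Z : pAlg F) := PAlgHom {
  palg_fun :> Y -> Z;
  palg_lin : linear palg_fun;
  palg_mul : forall x y (h : pdom (x, y)),
    exists h' : pdom (palg_fun x, palg_fun y),
      palg_fun (pmul h) = pmul h' }.

HB.instance Definition _ (F : fieldType) (Y Z : pAlg F) (f : palg_hom Y Z) :=
  GRing.isLinear.Build F Y Z *:%R (palg_fun f) (palg_lin f).

Lemma palg_homP (F : fieldType) (Y Z : pAlg F) (f g : palg_hom Y Z) :
  f =1 g -> f = g.
Proof.
case: f g => [f lf mf] [g lg mg] /= /funext fg; subst g.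
by congr PAlgHom; exact: Prop_irrelevance.
Qed.

Section PAlgCat.
Variable F : fieldType.
Implicit Types Y Z W : pAlg F.

Program Definition palg_id Y : palg_hom Y Y := @PAlgHom F Y Y id _ _.
Next Obligation. by []. Qed.
Next Obligation. by move=> Y x y h; exists h. Qed.

Program Definition palg_comp Y Z W (g : palg_hom Z W) (f : palg_hom Y Z)
  : palg_hom Y W := @PAlgHom F Y W (g \o f) _ _.
Next Obligation. by move=> Y Z W g f a x y /=; rewrite !linearP. Qed.
Next Obligation.
move=> Y Z W g f x y h /=; have [h' e] := palg_mul f h.
by have [h'' e'] := palg_mul g h'; exists h''; rewrite e.
Qed.

Program Definition PAlg : category :=
  @Category (pAlg F) (@palg_hom F) palg_id palg_comp _ _ _.
Next Obligation. by move=> *; exact: palg_homP. Qed.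
Next Obligation. by move=> *; exact: palg_homP. Qed.
Next Obligation. by move=> *; exact: palg_homP. Qed.

Program Definition palg_of_aca (A : acaAlg F) : pAlg F :=
  @PartialAlg F A setT (fun x y _ => amul x y) _ _ _ _.
Next Obligation. by []. Qed.
Next Obligation. by []. Qed.
Next Obligation. by move=> A a x x' y h1 h2 h3; exact: (amul_linl y). Qed.
Next Obligation. by move=> A a x x' y h1 h2 h3; exact: amul_linr. Qed.

Program Definition palg_of_aca_hom (A B : acaAlg F) (f : aca_hom A B)
  : palg_hom (palg_of_aca A) (palg_of_aca B) :=
  @PAlgHom F (palg_of_aca A) (palg_of_aca B) f (aca_lin f) _.
Next Obligation. by move=> A B f x y h; exists I; exact: aca_mul. Qed.

Program Definition forget : functor (ACAAssoc F) PAlg :=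
  @Functor (ACAAssoc F) PAlg palg_of_aca palg_of_aca_hom _ _.
Next Obligation. by move=> *; exact: palg_homP. Qed.
Next Obligation. by move=> *; exact: palg_homP. Qed.

(* A partial algebra is an object of ACAAssoc when its operation is total and
   satisfies the two identities; bilinearity is already part of [pAlg]. *)
Record is_aca (Y : pAlg F) : Prop := IsAca {
  is_aca_total : forall x y : Y, pdom (x, y);
  is_acaC : forall x y,
    pmul (is_aca_total x y) = - pmul (is_aca_total y x);
  is_acaA : forall x y z,
    pmul (is_aca_total x (pmul (is_aca_total y z))) =
    - pmul (is_aca_total (pmul (is_aca_total x y)) z) }.

Program Definition aca_of_palg (Y : pAlg F) (H : is_aca Y) : acaAlg F :=
  @AcaAlg F Y (fun x y => pmul (is_aca_total H x y)) _ _ _ _.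
Next Obligation. by move=> Y H x a u v /=; exact: pmul_linr. Qed.
Next Obligation. by move=> Y H x a u v /=; exact: pmul_linl. Qed.
Next Obligation. by move=> Y H x y; exact: is_acaC. Qed.
Next Obligation. by move=> Y H x y z; exact: is_acaA. Qed.

Lemma palg_eq (V : lmodType F) (d d' : set (V * V)) m m'
    sl sr ll lr sl' sr' ll' lr' :
    d = d' -> (forall x y h h', m x y h = m' x y h') ->
  @PartialAlg F V d m sl sr ll lr = @PartialAlg F V d' m' sl' sr' ll' lr'.
Proof.
move=> dd'; subst d' => mm'; have e : m = m'.
  apply: functional_extensionality_dep => x.
  apply: functional_extensionality_dep => y.
  by apply: functional_extensionality_dep => h; exact: mm'.
by subst m'; congr PartialAlg; exact: Prop_irrelevance.
Qed.

Lemma forget_aca_of_palg (Y : pAlg F) (H : is_aca Y) :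
  forget (aca_of_palg H) = Y.
Proof.
case: Y H => Y dom mul sl sr ll lr H; apply: palg_eq => [|x y h h'] /=.
  by apply/seteqP; split=> // -[x y] _; exact: (is_aca_total H x y).
by congr mul; exact: Prop_irrelevance.
Qed.

End PAlgCat.

Section Bracket.
Variables (F : fieldType) (X : acaAlg F).

Definition bracket_pred : {pred X -> X} := fun f =>
  `[< linear f /\ forall x y : X, f (amul x y) = - amul (f x) y >].

Fact bracket_submod_closed : submod_closed bracket_pred.
Proof.
split; first apply/asboolP; first split.
- by move=> a x y /=; rewrite scaler0 addr0.
- by move=> x y /=; rewrite amul0l oppr0.
move=> a f g /asboolP[lf mf] /asboolP[lg mg]; apply/asboolP; split.
  move=> b x y; rewrite addrfctE scalrfctE lf lg !scalerDr !scalerA mulrC.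
  by rewrite addrACA.
move=> x y; rewrite addrfctE scalrfctE mf mg (amul_linl y) opprD.
by rewrite scalerN.
Qed.

HB.instance Definition _ :=
  GRing.isSubmodClosed.Build F (X -> X) bracket_pred bracket_submod_closed.

Record bracket_car := BracketCar {
  bracket_val :> X -> X;
  bracket_valP : bracket_val \in bracket_pred }.

HB.instance Definition _ := [isSub for bracket_val].
HB.instance Definition _ := [Choice of bracket_car by <:].
HB.instance Definition _ := [SubChoice_isSubLmodule of bracket_car by <:].

Lemma bracket_lin (f : bracket_car) : linear (bracket_val f).
Proof. by have /asboolP[] := bracket_valP f. Qed.

Program Definition bracket : pAlg F :=
  @PartialAlg F bracket_car
    [set fg | (bracket_val fg.1 \o bracket_val fg.2) \in bracket_pred]
    (fun f g h => @BracketCar (- (bracket_val f \o bracket_val g)) _) _ _ _ _.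
Next Obligation. by move=> f g h; rewrite rpredN. Qed.
Next Obligation.
move=> g; split=> [|a f h] /=; first exact: (rpred0 bracket_pred).
move=> fP hP; have := rpredD (rpredZ a fP) hP.
exact.
Qed.
Next Obligation.
move=> g; split=> [|a f h] /=.
  have -> : bracket_val g \o bracket_val 0 = 0; last exact: rpred0.
  by apply/funext => x /=; have := bracket_lin g (-1) 0 0;
    rewrite scaler0 addr0 scaleN1r addNr.
move=> fP hP.
have -> : bracket_val g \o bracket_val (a *: f + h) =
  a *: (bracket_val g \o bracket_val f) + (bracket_val g \o bracket_val h).
  by apply/funext => x /=; rewrite (bracket_lin g).
exact: rpredD (rpredZ a fP) hP.
Qed.
Next Obligation.
move=> a f f' g h h' h''; apply: val_inj; apply/funext => x /=.
by rewrite !fctE opprD scalerN.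
Qed.
Next Obligation.
move=> a f f' g h h' h''; apply: val_inj; apply/funext => x /=.
by rewrite !fctE (bracket_lin g) opprD scalerN.
Qed.

End Bracket.

Section Pullback.
Variables (F : fieldType) (A B C : acaAlg F).
Variables (p : aca_hom A B) (f : aca_hom C B).

Definition pb_pred : {pred A * C} := fun u => p u.1 == f u.2.

Fact pb_submod_closed : submod_closed pb_pred.
Proof.
split=> [|a u v]; rewrite /in_mem /=; first by apply/eqP; rewrite /= !linear0.
by move=> /eqP pu /eqP pv; apply/eqP;
rewrite /= !linearP /= [p u.1]pu [p v.1]pv.
Qed.

HB.instance Definition _ :=
  GRing.isSubmodClosed.Build F (A * C)%type pb_pred pb_submod_closed.

Record pb_car := PbCar { pb_val :> A * C; pb_valP : pb_val \in pb_pred }.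

HB.instance Definition _ := [isSub for pb_val].
HB.instance Definition _ := [Choice of pb_car by <:].
HB.instance Definition _ := [SubChoice_isSubLmodule of pb_car by <:].

Lemma pbP (u : pb_car) : p (pb_val u).1 = f (pb_val u).2.
Proof. exact/eqP/(pb_valP u). Qed.

Lemma pb_inj (u v : pb_car) :
  (pb_val u).1 = (pb_val v).1 -> (pb_val u).2 = (pb_val v).2 -> u = v.
Proof.
by move=> e1 e2; apply: val_inj; apply: injective_projections.
Qed.

Program Definition pb_mul (u v : pb_car) : pb_car :=
  @PbCar (amul (pb_val u).1 (pb_val v).1, amul (pb_val u).2 (pb_val v).2) _.
Next Obligation. by move=> u v; apply/eqP; rewrite /= !aca_mul !pbP. Qed.

Program Definition pb : acaAlg F := @AcaAlg F pb_car pb_mul _ _ _ _.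
Next Obligation. by move=> u a v w; apply: pb_inj; exact: amul_linr. Qed.
Next Obligation. by move=> u a v w; apply: pb_inj; exact: (amul_linl _). Qed.
Next Obligation. by move=> u v; apply: pb_inj; exact: amulC. Qed.
Next Obligation. by move=> u v w; apply: pb_inj; exact: amulA. Qed.

Program Definition pb_fst : aca_hom pb A :=
  @AcaHom F pb A (fun u => (pb_val u).1) _ _.
Next Obligation. by []. Qed.
Next Obligation. by []. Qed.

Program Definition pb_snd : aca_hom pb C :=
  @AcaHom F pb C (fun u => (pb_val u).2) _ _.
Next Obligation. by []. Qed.
Next Obligation. by []. Qed.

Program Definition pb_pair (D : acaAlg F) (g : aca_hom D A) (h : aca_hom D C)
    (e : forall d, p (g d) = f (h d)) : aca_hom D pb :=
  @AcaHom F D pb (fun d => @PbCar (g d, h d) _) _ _.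
Next Obligation. by move=> D g h e d; exact/eqP/e. Qed.
Next Obligation. by move=> D g h e a u v; apply: pb_inj; rewrite /= linearP. Qed.
Next Obligation. by move=> D g h e u v; apply: pb_inj; rewrite /= aca_mul. Qed.

End Pullback.

Section SplitExtensions.
Variable F : fieldType.
Implicit Types A B C X : acaAlg F.

Program Definition aca_zero A B : aca_hom A B := @AcaHom F A B (fun=> 0) _ _.
Next Obligation. by move=> A B a x y /=; rewrite scaler0 addr0. Qed.
Next Obligation. by move=> A B x y /=; rewrite amul0l. Qed.

(* The kernel in the categorical sense: the equalizer of [p] and 0. *)
Definition is_kernel X A B (p : aca_hom A B) (i : aca_hom X A) : Prop :=
  aca_comp p i = aca_zero X B /\
  forall C (g : aca_hom C A), aca_comp p g = aca_zero C B ->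
    exists! h : aca_hom C X, aca_comp i h = g.

Record splitExt B X := SplitExt {
  se_obj : acaAlg F;
  se_ker : aca_hom X se_obj;
  se_proj : aca_hom se_obj B;
  se_sec : aca_hom B se_obj;
  se_projK : aca_comp se_proj se_sec = aca_id B;
  se_kerP : is_kernel se_proj se_ker }.

Definition se_iso B X (E E' : splitExt B X) : Prop :=
  exists (u : aca_hom (se_obj E) (se_obj E'))
         (v : aca_hom (se_obj E') (se_obj E)),
  [/\ aca_comp v u = aca_id (se_obj E), aca_comp u v = aca_id (se_obj E'),
      aca_comp u (se_ker E) = se_ker E', aca_comp (se_proj E') u = se_proj E
    & aca_comp u (se_sec E) = se_sec E'].

Lemma aca_compE A B C (g : aca_hom B C) (f : aca_hom A B) x :
  aca_comp g f x = g (f x).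
Proof. by []. Qed.

Lemma aca_eqE A B (f g : aca_hom A B) : f = g -> f =1 g.
Proof. by move=> ->. Qed.

Lemma se_projKE B X (E : splitExt B X) b : se_proj E (se_sec E b) = b.
Proof. exact: (aca_eqE (se_projK E) b). Qed.

Lemma se_proj_ker B X (E : splitExt B X) x : se_proj E (se_ker E x) = 0.
Proof. by have [/aca_eqE/(_ x)] := se_kerP E. Qed.

Program Definition se_pullback B B' X (f : aca_hom B' B) (E : splitExt B X)
    : splitExt B' X :=
  @SplitExt B' X (pb (se_proj E) f)
    (@pb_pair _ _ _ _ _ _ _ (se_ker E) (aca_zero X B') _)
    (pb_snd (se_proj E) f)
    (@pb_pair _ _ _ _ _ _ _ (aca_comp (se_sec E) f) (aca_id B') _) _ _.
Next Obligation.
by move=> B B' X f E x /=; rewrite linear0; exact: se_proj_ker.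
Qed.
Next Obligation. by move=> B B' X f E b; exact: se_projKE. Qed.
Next Obligation. by move=> B B' X f E; exact: aca_homP. Qed.
Next Obligation.
move=> B B' X f E; split; first exact: aca_homP.
move=> C g /aca_eqE g0; have [_ kerE] := se_kerP E.
have /kerE [h [hE hU]] :
    aca_comp (se_proj E) (aca_comp (pb_fst _ _) g) = aca_zero C B.
  by apply: aca_homP => c /=; rewrite pbP; have /= -> := g0 c; rewrite linear0.
exists h; split=> [|k kE].
  apply: aca_homP => c; apply: pb_inj; first exact: (aca_eqE hE c).
  by rewrite /=; have /= -> := g0 c.
by apply: hU; apply: aca_homP => c; have := aca_eqE kE c; move=> /= <-.
Qed.

Lemma se_iso_refl B X (E : splitExt B X) : se_iso E E.
Proof. by exists (aca_id _), (aca_id _); split; apply: aca_homP. Qed.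

Lemma se_iso_sym B X (E E' : splitExt B X) : se_iso E E' -> se_iso E' E.
Proof.
case=> u [v [vu uv ui pu us]]; exists v, u; split=> //; apply: aca_homP => x.
- by rewrite -ui aca_compE; exact: (aca_eqE vu).
- by rewrite -pu !aca_compE; congr (se_proj _ _); exact: (aca_eqE uv).
- by rewrite -us aca_compE; exact: (aca_eqE vu).
Qed.

Lemma se_iso_trans B X (E1 E2 E3 : splitExt B X) :
  se_iso E1 E2 -> se_iso E2 E3 -> se_iso E1 E3.
Proof.
case=> u [v [vu uv ui pu us]] [u' [v' [vu' uv' ui' pu' us']]].
exists (aca_comp u' u), (aca_comp v v'); split; apply: aca_homP => x.
- by have /= -> := aca_eqE vu' (u x); exact: (aca_eqE vu).
- by have /= -> := aca_eqE uv (v' x); exact: (aca_eqE uv').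
- by rewrite -ui' -ui.
- by rewrite -pu -pu'.
- by rewrite -us' -us.
Qed.

Lemma se_pullback_iso B B' X (f : aca_hom B' B) (E E' : splitExt B X) :
  se_iso E E' -> se_iso (se_pullback f E) (se_pullback f E').
Proof.
case=> u [v [vu uv ui pu us]].
have pv x : se_proj E (v x) = se_proj E' x.
  by rewrite -pu /=; congr (se_proj _ _); exact: (aca_eqE uv).
have e1 (z : pb (se_proj E) f) : se_proj E' (u (pb_val z).1) = f (pb_val z).2.
  by rewrite -pbP; exact: (aca_eqE pu).
have e2 (z : pb (se_proj E') f) : se_proj E (v (pb_val z).1) = f (pb_val z).2.
  by rewrite -pbP pv.
exists (@pb_pair _ _ _ _ _ _ _ (aca_comp u (pb_fst _ _)) (pb_snd _ _) e1).
exists (@pb_pair _ _ _ _ _ _ _ (aca_comp v (pb_fst _ _)) (pb_snd _ _) e2).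
split; apply: aca_homP => x //; apply: pb_inj => //=.
- exact: (aca_eqE vu).
- exact: (aca_eqE uv).
- by rewrite -ui.
- by rewrite -us.
Qed.

Lemma se_pullback1 B X (E : splitExt B X) : se_iso (se_pullback (aca_id B) E) E.
Proof.
have e (x : se_obj E) : se_proj E (aca_id _ x) = aca_id B (se_proj E x) by [].
exists (pb_fst _ _), (@pb_pair _ _ _ _ _ _ _ (aca_id _) (se_proj E) e).
split; apply: aca_homP => x //; last exact: pbP.
by apply: pb_inj => //=; exact: pbP.
Qed.

Lemma se_pullbackM B B' B'' X (g : aca_hom B' B) (f : aca_hom B'' B')
    (E : splitExt B X) :
  se_iso (se_pullback (aca_comp g f) E) (se_pullback f (se_pullback g E)).
Proof.
have e1 (z : pb (se_proj E) (aca_comp g f)) :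
    se_proj E (pb_fst _ _ z) = g (aca_comp f (pb_snd _ _) z) by exact: pbP.
pose u1 := @pb_pair _ _ _ _ _ _ _ (pb_fst _ _) (aca_comp f (pb_snd _ _)) e1.
have e2 (z : pb (se_proj E) (aca_comp g f)) :
    se_proj (se_pullback g E) (u1 z) = f (pb_snd _ _ z) by [].
pose T := pb (se_proj (se_pullback g E)) f.
have e3 (z : T) : se_proj E (aca_comp (pb_fst _ _) (pb_fst _ _) z) =
    aca_comp g f (pb_snd _ _ z).
  by rewrite /= pbP; congr (g _); exact: (pbP z).
exists (@pb_pair _ _ _ _ _ _ _ u1 (pb_snd _ _) e2).
exists (@pb_pair _ _ _ _ _ _ _
  (aca_comp (pb_fst _ _) (pb_fst _ _)) (pb_snd _ _) e3).
split; apply: aca_homP => z //; apply: pb_inj => //; apply: pb_inj => //=.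
- by rewrite -(pbP z).
- by rewrite linear0.
Qed.

(* An isomorphism class, as the predicate of its members. *)
Definition se_class B X :=
  {K : splitExt B X -> Prop | exists E, K = se_iso E}.

Lemma se_classP B X (K L : se_class B X) : sval K = sval L -> K = L.
Proof.
case: K L => [K hK] [L hL] /= e; subst L.
by congr exist; exact: Prop_irrelevance.
Qed.

Lemma se_class_eq B X (E E' : splitExt B X) :
  se_iso E E' -> se_iso E = se_iso E'.
Proof.
move=> EE'; apply/funext => D; apply/propext; split; last exact: se_iso_trans.
by apply: se_iso_trans; exact: se_iso_sym.
Qed.

Lemma se_pullback_class B B' X (f : aca_hom B' B) (E : splitExt B X) :
  (fun E' => exists2 D, se_iso E D & se_iso (se_pullback f D) E') =
  se_iso (se_pullback f E).
Proof.
apply/funext => E'; apply/propext; split; last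
  by exists E => //; exact: se_iso_refl.
by case=> D ED; apply: se_iso_trans; exact: se_pullback_iso.
Qed.

Program Definition se_class_pullback B B' X (f : aca_hom B' B)
    (K : se_class B X) : se_class B' X :=
  exist _ (fun E' => exists2 E, sval K E & se_iso (se_pullback f E) E') _.
Next Obligation.
move=> B B' X f [K [E KE]] /=; subst K; exists (se_pullback f E).
exact: se_pullback_class.
Qed.

Program Definition SplExt X : presheaf (ACAAssoc F) :=
  @Presheaf (ACAAssoc F) (fun B => se_class B X)
    (fun B' B f => se_class_pullback f) _ _.
Next Obligation.
move=> X B [K [E KE]]; apply: se_classP => /=; subst K.
by rewrite se_pullback_class; apply: se_class_eq; exact: se_pullback1.
Qed.
Next Obligation.
move=> X B'' B' B g f [K [E KE]]; apply: se_classP => /=; subst K.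
rewrite !se_pullback_class; apply: se_class_eq; exact: se_pullbackM.
Qed.

Definition is_actor X (Z : acaAlg F) : Prop :=
  inhabited (nat_iso (SplExt X) (@homTo (ACAAssoc F) Z)).

End SplitExtensions.

(* Main.v *)
(* A split extension of B by X makes B act on X by b.x = s(b) i(x), and
   anti-associativity of the total algebra says exactly that b |-> (x |-> b.x)
   is a homomorphism of partial algebras from B to [X].  Conversely such a
   homomorphism phi gives the semidirect product X x B with
   (x, b)(y, c) = (xy + phi_b y - phi_c x, bc), and every split extension is
   isomorphic to the semidirect product of its own action, via e = i x + s b. *)

Require Import Defs.
From HB Require Import structures.
From mathcomp Require Import all_boot all_algebra.
From mathcomp Require Import boolp classical_sets functions.

Set Implicit Arguments.
Unset Strict Implicit.
Unset Printing Implicit Defensive.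

Import GRing.Theory.
Local Open Scope ring_scope.
Local Obligation Tactic := idtac.

(** * Additivity and signs of the product *)

Section AlgebraFacts.
Variables (F : fieldType) (A : acaAlg F).
Implicit Types x y z : A.

Lemma amulDl x y z : amul (x + y) z = amul x z + amul y z.
Proof. by have /= := amul_linl z 1 x y; rewrite !scale1r. Qed.

Lemma amulDr x y z : amul z (x + y) = amul z x + amul z y.
Proof. by have := amul_linr z 1 x y; rewrite !scale1r. Qed.

Lemma amulNl x y : amul (- x) y = - amul x y.
Proof.
by have /= := amul_linl y (-1) x 0; rewrite !addr0 amul0l addr0 !scaleN1r.
Qed.

Lemma amulNr x y : amul x (- y) = - amul x y.
Proof. by rewrite amulC amulNl opprK amulC. Qed.

End AlgebraFacts.

(** * Elements of $[X]$ against the product of $X$ *)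

Section Brackets.
Variables (F : fieldType) (X : acaAlg F).
Implicit Types f g : bracket X.

HB.instance Definition _ (f : bracket_car X) :=
  GRing.isLinear.Build F X X *:%R (bracket_val f) (bracket_lin f).

Lemma bracket_inj f g : bracket_val f =1 bracket_val g -> f = g.
Proof. by move=> fg; apply: val_inj; apply/funext. Qed.

Lemma bracketM f x y : bracket_val f (amul x y) = - amul (bracket_val f x) y.
Proof. by have /asboolP[_] := bracket_valP f. Qed.

(** Anti-commutativity transfers the defining rule to the second factor: $x f(y) = -f(y)x = f(yx) =
    -f(xy) = f(x)y$. *)
Lemma bracket_swap f x y :
  amul x (bracket_val f y) = amul (bracket_val f x) y.
Proof.
by rewrite (amulC x) -bracketM (amulC y) linearN /= bracketM opprK.
Qed.

End Brackets.

(** * From a split extension to its action *)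

Section KernelRetraction.
Variables (F : fieldType) (B X : acaAlg F) (E : splitExt B X).
Local Notation A := (se_obj E).
Local Notation p := (se_proj E).
Local Notation i := (se_ker E).
Local Notation s := (se_sec E).

(* Apply the universal property to the pullback of [i] along 0: its
   projection to [X] and 0 become equal after composing with [i]. *)
Lemma se_ker_inj : injective i.
Proof.
suff i0 x : i x = 0 -> x = 0.
  by move=> x y xy; apply/subr0_eq/i0; rewrite linearB /= xy subrr.
move=> ix0; pose K := pb i (aca_zero X A).
have [_ kerE] := se_kerP E.
have pi0 (h : aca_hom K X) : aca_comp p (aca_comp i h) = aca_zero K B.
  by apply: aca_homP => z; exact: se_proj_ker.
have [h [_ hU]] := kerE K _ (pi0 (aca_zero K X)).
have fst0 : aca_comp i (pb_fst i (aca_zero X A)) = aca_comp i (aca_zero K X).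
  by apply: aca_homP => z /=; rewrite linear0; exact: pbP.
have xP : (x, 0) \in pb_pred i (aca_zero X A) by exact/eqP.
have := hU _ fst0; rewrite (hU _ erefl) => /aca_eqE/(_ (PbCar xP)) /= ->.
by [].
Qed.

(* Apply the universal property to the pullback of [p] along 0. *)
Lemma se_ker_full (a : A) : p a = 0 -> exists x, i x = a.
Proof.
move=> pa0; pose K := pb p (aca_zero A B).
have [_ kerE] := se_kerP E.
have /kerE[h [/aca_eqE hE _]] :
    aca_comp p (pb_fst p (aca_zero A B)) = aca_zero K B.
  by apply: aca_homP => z; exact: pbP.
have aP : (a, 0) \in pb_pred p (aca_zero A B) by exact/eqP.
by exists (h (PbCar aP)); exact: hE.
Qed.

Fact se_retr_ex (a : A) : exists x, i x = a - s (p a).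
Proof. by apply: se_ker_full; rewrite linearB /= se_projKE subrr. Qed.

(** The $X$-coordinate in $A = i(X) \oplus s(B)$. Injectivity of [i] makes the chosen preimage
    unique, whence linearity. *)
Definition se_retr (a : A) : X := projT1 (cid (se_retr_ex a)).

Lemma se_retrE a : i (se_retr a) = a - s (p a).
Proof. exact: projT2 (cid (se_retr_ex a)). Qed.

Lemma se_decomp a : a = i (se_retr a) + s (p a).
Proof. by rewrite se_retrE subrK. Qed.

Lemma se_retr_eq a x : i x = a - s (p a) -> se_retr a = x.
Proof. by move=> ix; apply: se_ker_inj; rewrite ix se_retrE. Qed.

Lemma se_retr_linear : linear se_retr.
Proof.
move=> c a b; apply: se_retr_eq.
by rewrite linearP /= !se_retrE !linearP /= scalerDr addrACA.
Qed.

HB.instance Definition _ :=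
  GRing.isLinear.Build F A X *:%R se_retr se_retr_linear.

Lemma se_retr_ker x : se_retr (i x) = x.
Proof. by apply: se_retr_eq; rewrite se_proj_ker linear0 subr0. Qed.

Lemma se_retr_sec b : se_retr (s b) = 0.
Proof. by apply: se_retr_eq; rewrite se_projKE subrr linear0. Qed.

Definition se_act (b : B) (x : X) : X := se_retr (amul (s b) (i x)).

(** The product lies in the kernel of [p], so the correction term $s(p(-))$ of the retraction
    vanishes. *)
Lemma se_actE b x : i (se_act b x) = amul (s b) (i x).
Proof.
by rewrite se_retrE aca_mul se_proj_ker amul0r linear0 subr0.
Qed.

(** Anti-associativity of the triple $s(b), i(x), i(y)$. *)
Lemma se_act_bracket b : se_act b \in @bracket_pred F X.
Proof.
apply/asboolP; split=> [a x y|x y]; apply: se_ker_inj.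
  by rewrite linearP /= !se_actE linearP amul_linr.
by rewrite linearN /= aca_mul !se_actE aca_mul amulA.
Qed.

(** Anti-associativity of the triple $s(b), s(c), i(x)$. *)
Lemma se_actM b c : se_act (amul b c) = - (se_act b \o se_act c) :> (X -> X).
Proof.
apply/funext => x; apply: se_ker_inj.
by rewrite [RHS]linearN /= !se_actE aca_mul amulA opprK.
Qed.

Definition se_act_br (b : B) : bracket X := BracketCar (se_act_bracket b).

Lemma se_act_br_linear : linear se_act_br.
Proof.
move=> a b c; apply: bracket_inj => x /=; apply: se_ker_inj.
by rewrite se_actE linearP amul_linl [RHS]linearP /= !se_actE.
Qed.

Lemma se_act_br_mul (b c : forget F B) (h : pdom (b, c)) :
  exists h' : pdom (se_act_br b, se_act_br c),
    se_act_br (pmul h) = pmul h'.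
Proof.
have h' : pdom (se_act_br b, se_act_br c).
  (* The composite is minus the action of $bc$, so it stays in $[X]$: the partial product is
     defined. *)
  rewrite /= /mkset /= -[_ \o _]opprK rpredN -se_actM.
  exact: se_act_bracket.
by exists h'; apply: bracket_inj => x /=; rewrite se_actM.
Qed.

Definition se_act_hom : palg_hom (forget F B) (bracket X) :=
  @PAlgHom F (forget F B) (bracket X) se_act_br se_act_br_linear se_act_br_mul.

(** Expand both factors by [se_decomp]: the product of the two sections cancels against $s(p(ab))$,
    and anti-commutativity gives the minus sign. Hence the action determines the product of $A$. *)
Lemma se_retrM a b : se_retr (amul a b) = amul (se_retr a) (se_retr b)
  + (se_act (p a) (se_retr b) - se_act (p b) (se_retr a)).
Proof.
apply: se_ker_inj; rewrite se_retrE linearD linearB /= !se_actE !aca_mul.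
rewrite {1}(se_decomp a) {1}(se_decomp b) !amulDl !amulDr addrA addrK.
by rewrite [amul (s (p b)) _]amulC opprK addrAC addrA.
Qed.

End KernelRetraction.

(** The action is defined by products of $s(b)$ and $i(x)$, which an isomorphism carries to their
    counterparts. *)
Lemma se_iso_act (F : fieldType) (B X : acaAlg F) (E E' : splitExt B X) :
  se_iso E E' -> se_act_hom E = se_act_hom E'.
Proof.
case=> u [_ [_ _ /aca_eqE ui _ /aca_eqE us]]; apply: palg_homP => b.
apply: bracket_inj => x; apply: (@se_ker_inj _ _ _ E') => /=.
rewrite -ui aca_compE !se_actE aca_mul.
by rewrite -(us b) -(ui x).
Qed.

(** * Extensions with equal actions are isomorphic *)

Section Comparison.
Variables (F : fieldType) (B X : acaAlg F) (E E' : splitExt B X).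
Hypothesis EE' : forall b x, se_act E b x = se_act E' b x.

Definition se_cmp (a : se_obj E) : se_obj E' :=
  se_ker E' (se_retr a) + se_sec E' (se_proj E a).

Lemma se_cmp_linear : linear se_cmp.
Proof.
by move=> c a b; rewrite /se_cmp !linearP /= scalerDr addrACA.
Qed.

Lemma se_retr_cmp a : se_retr (se_cmp a) = se_retr a.
Proof. by rewrite linearD /= se_retr_ker se_retr_sec addr0. Qed.

Lemma se_proj_cmp a : se_proj E' (se_cmp a) = se_proj E a.
Proof. by rewrite linearD /= se_proj_ker se_projKE add0r. Qed.

(** By [se_retrM] the coordinates of a product depend only on those of the factors and on the
    action, which is common to both sides. *)
Lemma se_cmpM a b : se_cmp (amul a b) = amul (se_cmp a) (se_cmp b).
Proof.
rewrite [RHS]se_decomp se_retrM aca_mul !se_retr_cmp !se_proj_cmp.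
by rewrite /se_cmp se_retrM aca_mul !EE'.
Qed.

Definition se_cmp_hom : aca_hom (se_obj E) (se_obj E') :=
  AcaHom se_cmp_linear se_cmpM.

End Comparison.

Lemma se_act_iso (F : fieldType) (B X : acaAlg F) (E E' : splitExt B X) :
  se_act_hom E = se_act_hom E' -> se_iso E E'.
Proof.
move=> EE'.
have e b x : se_act E b x = se_act E' b x.
  by have /= := congr1 (fun f : palg_hom (forget F B) (bracket X) =>
    bracket_val (f b) x) EE'.
have e' b x : se_act E' b x = se_act E b x by [].
exists (se_cmp_hom e), (se_cmp_hom e'); split; apply: aca_homP => a /=.
- by rewrite {1}/se_cmp se_retr_cmp se_proj_cmp -se_decomp.
- by rewrite {1}/se_cmp se_retr_cmp se_proj_cmp -se_decomp.
- by rewrite /se_cmp se_retr_ker se_proj_ker linear0 addr0.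
- exact: se_proj_cmp.
- by rewrite /se_cmp se_retr_sec se_projKE linear0 add0r.
Qed.

(** * From an action to the semidirect product *)

Section Semidirect.
Variables (F : fieldType) (B X : acaAlg F).
Variable phi : palg_hom (forget F B) (bracket X).
Local Notation act b := (bracket_val (phi b)).

Lemma act_mul (b c : B) x : act (amul b c) x = - act b (act c x).
Proof.
have [h e] := palg_mul phi (I : pdom (p := forget F B) (b, c)).
by have /= -> := e.
Qed.

Lemma act_linear x : linear (fun b : B => act b x).
Proof. by move=> a b c /=; rewrite (palg_lin phi). Qed.

Lemma act0l x : act 0 x = 0.
Proof. by rewrite linear0. Qed.

Lemma act0r b : act b 0 = 0.
Proof. exact: linear0. Qed.

(** Both composites are, up to sign, actions of $bc$ and $cb = -bc$. *)
Lemma act_anti (b c : B) x : act b (act c x) = - act c (act b x).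
Proof.
have actN d : act (- d) x = - act d x.
  by rewrite -scaleN1r -[_ *: d]addr0 act_linear !scaleN1r act0l addr0.
by apply: oppr_inj; rewrite -!act_mul amulC actN.
Qed.

Definition sd_mul (u v : X * B) : X * B :=
  (amul u.1 v.1 + (act u.2 v.1 - act v.2 u.1), amul u.2 v.2).

Lemma sd_linr u : linear (sd_mul u).
Proof.
move=> a v w; congr pair; last exact: amul_linr.
rewrite /= amul_linr linearP (act_linear u.1) opprD.
rewrite !scalerDr !scalerN (addrACA (a *: act u.2 v.1)).
exact: addrACA.
Qed.

Lemma sd_mulC u v : sd_mul u v = - sd_mul v u.
Proof.
congr pair; last exact: amulC.
by rewrite /= amulC opprD opprB.
Qed.

Lemma sd_linl v : linear (sd_mul ^~ v).
Proof.
by move=> a u w /=; rewrite sd_mulC sd_linr opprD -scalerN -!sd_mulC.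
Qed.

Lemma sd_mulA u v w : sd_mul u (sd_mul v w) = - sd_mul (sd_mul u v) w.
Proof.
congr pair; last exact: amulA.
case: u v w => [x a] [y b] [z c] /=.
(* Normal form in $X$: actions sit on the left factor of a product, and actions of products in $B$
   become composites in a fixed order. Both sides are then the same seven terms, up to a
   permutation. *)
rewrite !amulDl !amulDr amulNl amulNr amulA !bracket_swap.
have actD d u v : act d (u + v) = act d u + act d v by exact: linearD.
have actN d u : act d (- u) = - act d u by exact: linearN.
rewrite !actD !actN !bracketM !act_mul (act_anti c a) (act_anti c b).
rewrite !opprD !opprK.
by rewrite [LHS](AC ((1*2)*(1*2*1)) ((1*(4*2))*(5*(3*(6*7))))).
Qed.

Definition sd : acaAlg F := AcaAlg sd_linr sd_linl sd_mulC sd_mulA.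

Program Definition sd_inl : aca_hom X sd :=
  @AcaHom F X sd (fun x => (x, 0)) _ _.
Next Obligation. by move=> a x y; congr pair; rewrite /= scaler0 addr0. Qed.
Next Obligation.
move=> x y; congr pair => /=; last by rewrite amul0l.
by rewrite !act0l subrr addr0.
Qed.

Program Definition sd_inr : aca_hom B sd :=
  @AcaHom F B sd (fun b => (0, b)) _ _.
Next Obligation. by move=> a b c; congr pair; rewrite /= scaler0 addr0. Qed.
Next Obligation.
by move=> b c; congr pair => /=; rewrite amul0l !act0r subrr addr0.
Qed.

Program Definition sd_proj : aca_hom sd B := @AcaHom F sd B snd _ _.
Next Obligation. by []. Qed.
Next Obligation. by []. Qed.

Lemma sd_kernel : is_kernel sd_proj sd_inl.
Proof.
split=> [|C g /aca_eqE g0]; first exact: aca_homP.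
have gE c : g c = ((g c).1, 0) by rewrite [LHS]surjective_pairing [(g c).2]g0.
have hlin : linear (fun c => (g c).1) by move=> a x y /=; rewrite linearP.
(* The $B$-coordinates of [g] vanish, so the action terms of the product do too. *)
have hmul x y : (g (amul x y)).1 = amul (g x).1 (g y).1.
  by rewrite aca_mul (gE x) (gE y) /= !act0l subrr addr0.
exists (AcaHom hlin hmul); split; first by apply: aca_homP => c; rewrite gE.
by move=> h /aca_eqE hg; apply: aca_homP => c /=; rewrite -(hg c).
Qed.

Lemma sd_projK : aca_comp sd_proj sd_inr = aca_id B.
Proof. exact: aca_homP. Qed.

Definition sd_ext : splitExt B X := SplitExt sd_projK sd_kernel.

Lemma sd_extK : se_act_hom sd_ext = phi.
Proof.
apply: palg_homP => b; apply: bracket_inj => x.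
apply: (@se_ker_inj _ _ _ sd_ext); rewrite se_actE /=.
by congr pair => /=; rewrite ?amul0r // amul0l act0l subr0 add0r.
Qed.

End Semidirect.

(** This is naturality: the pullback multiplies coordinatewise, and $(s(f(b)), b)(i(x), 0)$ has
    first coordinate $s(f(b))\,i(x)$. *)
Lemma se_act_pullback (F : fieldType) (B B' X : acaAlg F) (f : aca_hom B' B)
    (E : splitExt B X) :
  se_act_hom (se_pullback f E) =
  palg_comp (se_act_hom E) (palg_of_aca_hom f).
Proof.
apply: palg_homP => b; apply: bracket_inj => x.
apply: (@se_ker_inj _ _ _ (se_pullback f E)); rewrite se_actE.
by apply: pb_inj; rewrite /= ?amul0r // se_actE.
Qed.

(** * Isomorphism classes and the natural isomorphism *)

Section Classes.
Variables (F : fieldType) (X : acaAlg F).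

Definition se_class_of (B : acaAlg F) (E : splitExt B X) : se_class B X :=
  exist _ (se_iso E) (ex_intro _ E erefl).

Definition class_act (B : acaAlg F) (K : se_class B X) :
    palg_hom (forget F B) (bracket X) :=
  se_act_hom (projT1 (cid (proj2_sig K))).

Lemma class_actE (B : acaAlg F) (E : splitExt B X) :
  class_act (se_class_of E) = se_act_hom E.
Proof.
rewrite /class_act; case: cid => E' /= EE'.
by apply: se_iso_act; rewrite -EE'; exact: se_iso_refl.
Qed.

Lemma se_class_ofP (B : acaAlg F) (K : se_class B X) :
  exists E, K = se_class_of E.
Proof. by case: K => [K [E KE]]; exists E; exact: se_classP. Qed.

Lemma class_act_bij (B : acaAlg F) : bijective (@class_act B).
Proof.
(* The inverse is the class of the semidirect product. *)
exists (fun phi => se_class_of (sd_ext phi)) => [K|phi]; last first.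
  by rewrite class_actE sd_extK.
have [E ->] := se_class_ofP K; apply/se_classP/se_class_eq/se_act_iso.
by rewrite sd_extK class_actE.
Qed.

Lemma class_act_comm (B' B : acaAlg F) (f : aca_hom B' B) (K : se_class B X) :
  class_act (se_class_pullback f K) =
  palg_comp (class_act K) (palg_of_aca_hom f).
Proof.
have [E ->] := se_class_ofP K.
have -> : se_class_pullback f (se_class_of E) = se_class_of (se_pullback f E).
  by apply: se_classP; exact: se_pullback_class.
by rewrite !class_actE se_act_pullback.
Qed.

Definition SplExt_iso : nat_iso (SplExt X)
    (precomp (@homTo (PAlg F) (bracket X)) (forget F)) :=
  @NatIso (ACAAssoc F) (SplExt X)
    (precomp (@homTo (PAlg F) (bracket X)) (forget F))
    class_act class_act_bij class_act_comm.

End Classes.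

Lemma nat_iso_trans (C : category) (P Q R : presheaf C) :
  nat_iso P Q -> nat_iso Q R -> nat_iso P R.
Proof.
move=> s t; apply: (@NatIso C P R (fun a => t a \o s a)) => [a|a b f x] /=.
  by apply: bij_comp; exact: nat_bij.
by rewrite !nat_comm.
Qed.

(** * Partial algebras that lie in $\mathbf{ACAAssoc}$ *)

Section TotalTarget.
Variables (F : fieldType) (Y : pAlg F) (H : is_aca Y).

Lemma total_aca_mul (B : acaAlg F) (f : palg_hom (forget F B) Y) (x y : B) :
  f (amul x y) = amul (f x : aca_of_palg H) (f y).
Proof.
have [h e] := palg_mul f (I : pdom (p := forget F B) (x, y)).
by rewrite [LHS]e; congr pmul; exact: Prop_irrelevance.
Qed.

Definition total_to_aca (B : acaAlg F) (f : palg_hom (forget F B) Y) :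
    aca_hom B (aca_of_palg H) :=
  @AcaHom F B (aca_of_palg H) f (palg_lin f) (total_aca_mul f).

Lemma total_of_aca_mul (B : acaAlg F) (f : aca_hom B (aca_of_palg H))
    (x y : forget F B) (h : pdom (x, y)) :
  exists h' : pdom (p := Y) (f x, f y), f (pmul h) = pmul h'.
Proof. by exists (is_aca_total H _ _); exact: aca_mul. Qed.

Definition total_of_aca (B : acaAlg F) (f : aca_hom B (aca_of_palg H)) :
    palg_hom (forget F B) Y :=
  @PAlgHom F (forget F B) Y f (aca_lin f) (total_of_aca_mul f).

Lemma total_to_aca_bij (B : acaAlg F) : bijective (@total_to_aca B).
Proof.
by exists (@total_of_aca B) => f; [exact: palg_homP|exact: aca_homP].
Qed.

Lemma total_to_aca_comm (B' B : acaAlg F) (f : aca_hom B' B)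
    (g : palg_hom (forget F B) Y) :
  total_to_aca (palg_comp g (palg_of_aca_hom f)) =
  aca_comp (total_to_aca g) f.
Proof. exact: aca_homP. Qed.

(** Full faithfulness of the forgetful functor, on maps into [aca_of_palg H]. It is stated with [Y]
    itself to avoid transport along [forget_aca_of_palg]. *)
Definition total_homTo_iso :
    nat_iso (precomp (@homTo (PAlg F) Y) (forget F))
      (@homTo (ACAAssoc F) (aca_of_palg H)) :=
  @NatIso (ACAAssoc F) (precomp (@homTo (PAlg F) Y) (forget F))
    (@homTo (ACAAssoc F) (aca_of_palg H))
    total_to_aca total_to_aca_bij total_to_aca_comm.

End TotalTarget.

Theorem theorem2p20 (F : fieldType) (X : acaAlg F) :
  inhabited (nat_iso (SplExt X)
    (precomp (@homTo (PAlg F) (bracket X)) (forget F))) /\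
  (forall H : is_aca (bracket X),
    representable (SplExt X) /\ is_actor X (aca_of_palg H)).
Proof.
split=> [|H]; first exact: inhabits (SplExt_iso X).
have actor : is_actor X (aca_of_palg H).
  exact: inhabits (nat_iso_trans (SplExt_iso X) (total_homTo_iso H)).
by split=> //; exists (aca_of_palg H).
Qed.
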